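(* Let $\star$ be a finite character star operation on an integral domain $D$. Then the monoid $\varphi_{\star}(D)$ of nonzero integral $\star$-ideals of finite type of $D$, under $\star$-multiplication, with order defined by $I\leq J$ if and only if $I\supseteq J$ for $I,J\in\varphi_{\star}(D)$, is a $\wedge$-smooth pre-Riesz monoid. Moreover the following hold: (1) $D$ is a $\star$-SH domain if and only if $\varphi_{\star}(D)$ is a v-factorial monoid. (2) If $h(\varphi_{\star}(D))\neq\emptyset$, then $H_{h}(\varphi_{\star}(D))$ is a v-factorial monoid.
   Context: Star operations: $D$ is an integral domain with quotient field $K\ne D$; $F(D)$ (resp. $f(D)$) is the set of nonzero (resp. nonzero finitely generated) fractional ideals. A star operation is a map $I\mapsto I^\star$ on $F(D)$ such that for all $I,J\in F(D)$, $0\ne x\in K$: $(x)^{\star}=(x)$, $(xI)^{\star}=xI^{\star}$; $I\subseteq I^{\star}$, and $I\subseteq J\Rightarrow I^{\star}\subseteq J^{\star}$; $(I^{\star})^{\star}=I^{\star}$. It is of finite character if $I^{\star}=\bigcup\{J^{\star}: J\subseteq I, J\in f(D)\}$ for all $I$. $I\in F(D)$ is a $\star$-ideal if $I=I^\star$, and a $\star$-ideal of finite type if $I=J^{\star}$ for some $J\in f(D)$. $\star$-multiplication is $I\times^{\star}J=(IJ)^{\star}$. In $\varphi_\star(D)$ the identity and least element is $e=D$, and $I\wedge J=(I+J)^{\star}$. A proper (meaning $\ne D$) ideal $\mathbf h\in\varphi_\star(D)$ is a homogeneous ideal if for all proper $\mathbf j,\mathbf k\in\varphi_\star(D)$ containing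 $\mathbf h$ one has $(\mathbf j+\mathbf k)^{\star}\neq D$. $D$ is a $\star$-semi homogeneous ($\star$-SH) domain if every proper nonzero principal ideal of $D$ is a $\star$-product of finitely many homogeneous ideals. Monoids: all monoids are commutative. A p.o. monoid $\langle M,\ast,e,\le\rangle$ satisfies $x\le y\Rightarrow z\ast x\le z\ast y$; it is directed if any two elements have a common upper bound and a common lower bound; it is conic if $x\ast y=e$ implies $x=y=e$. A pre-Riesz monoid is a directed p.o. monoid with least element $e$ such that for any $x_1,\dots,x_n\in M\setminus\{e\}$ either $\mathrm{glb}(x_1,\dots,x_n)=e$ or there is $r\in M$ with $e<r\le x_1,\dots,x_n$. $M$ is $\wedge$-smooth if whenever $x\wedge y$ exists, $z\ast(x\wedge y)=(z\ast x)\wedge(z\ast y)$ for all $z$, and whenever $x\wedge(y\wedge z)$ or $(x\wedge y)\wedge z$ exists they are equal. Elements $x,y$ are disjoint if $x\wedge y=e$. $h\in M$ is homogeneous if $h>e$ and for all $u,v$ with $e<u,v\le h$ there is $l\in M$ with $e<l\le u,v$; $h(M)$ is the set of homogeneous elements of $M$, and $H_h(M)=\{h_1\ast\cdots\ast h_n: n\ge1, h_i\in h(M)\}\cup\{e\}$, with the operation and order induced from $M$. A directed p.o. monoid $M$ is semi-homogeneous if it is conic and each strictly positive element is a finite product (under $\ast$) of homogeneous elements; it is virtually factorial (v-factorial) if it is semi-homogeneous and every strictly positive element is uniquely (up to order) expressible as a product of finitely many mutually disjoint homogeneous elements. *)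

(* Defs.v *)
From mathcomp Require Import all_boot all_order all_algebra.
From mathcomp Require Import fraction.
From mathcomp Require Import boolp classical_sets functions.

Set Implicit Arguments.
Unset Strict Implicit.
Unset Printing Implicit Defensive.

Import GRing.Theory.
Local Open Scope ring_scope.
Local Open Scope classical_set_scope.


(* The data of a p.o. monoid carried by a subset of an ambient type [T]: only
   the restrictions of [pmul] and [ple] to [pset] are meaningful, and every
   notion below quantifies over [pset] only.  A submonoid with the induced
   operation and order is obtained by replacing [pset]. *)
Record pomonoid_data (T : Type) := POMonoidData {
  pset : set T;
  pmul : T -> T -> T;
  pone : T;
  ple : T -> T -> Prop
}.

Section POMonoid.
Context {T : Type}.
Implicit Types (M : pomonoid_data T) (x y z : T).

Record is_pomonoid M : Prop := IsPOMonoid {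
  pone_in : pset M (pone M);
  pmul_in : forall x y, pset M x -> pset M y -> pset M (pmul M x y);
  pmulA : forall x y z, pset M x -> pset M y -> pset M z ->
    pmul M x (pmul M y z) = pmul M (pmul M x y) z;
  pmulC : forall x y, pset M x -> pset M y -> pmul M x y = pmul M y x;
  pmul1 : forall x, pset M x -> pmul M (pone M) x = x;
  ple_refl : forall x, pset M x -> ple M x x;
  ple_anti : forall x y, pset M x -> pset M y ->
    ple M x y -> ple M y x -> x = y;
  ple_trans : forall x y z, pset M x -> pset M y -> pset M z ->
    ple M x y -> ple M y z -> ple M x z;
  ple_mul : forall x y z, pset M x -> pset M y -> pset M z ->
    ple M x y -> ple M (pmul M z x) (pmul M z y)
}.

Definition plt M x y := ple M x y /\ x <> y.

Definition directed M := forall x y, pset M x -> pset M y ->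
  (exists u, [/\ pset M u, ple M x u & ple M y u]) /\
  (exists l, [/\ pset M l, ple M l x & ple M l y]).

Definition conic M := forall x y, pset M x -> pset M y ->
  pmul M x y = pone M -> x = pone M /\ y = pone M.

Definition lower_bound M (A : set T) l :=
  pset M l /\ forall x, A x -> ple M l x.

Definition is_glb M (A : set T) g :=
  lower_bound M A g /\ forall l, lower_bound M A l -> ple M l g.

(* The meet is a relation since it need not exist. *)
Definition is_meet M x y w := is_glb M [set x; y] w.

Definition pre_Riesz M :=
  [/\ is_pomonoid M,
      directed M,
      (forall x, pset M x -> ple M (pone M) x)
    & forall (n : nat) (x : 'I_n.+1 -> T),
        (forall i, pset M (x i) /\ x i <> pone M) ->
        is_glb M (range x) (pone M) \/
        exists r, [/\ pset M r, plt M (pone M) r & forall i, ple M r (x i)]].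

(* The second clause says that one of [x /\ (y /\ z)] and [(x /\ y) /\ z]
   exists if and only if the other one does, and that they are then equal. *)
Definition meet_smooth M :=
  (forall x y w, pset M x -> pset M y -> is_meet M x y w ->
     forall z, pset M z ->
       is_meet M (pmul M z x) (pmul M z y) (pmul M z w)) /\
  (forall x y z w, pset M x -> pset M y -> pset M z ->
     (exists2 u, is_meet M y z u & is_meet M x u w) <->
     (exists2 v, is_meet M x y v & is_meet M v z w)).

Definition disjoint_elements M x y := is_meet M x y (pone M).

Definition homogeneous M : set T := [set h |
  [/\ pset M h, plt M (pone M) h &
    forall u v, pset M u -> pset M v ->
      plt M (pone M) u -> ple M u h -> plt M (pone M) v -> ple M v h ->
      exists l, [/\ pset M l, plt M (pone M) l, ple M l u & ple M l v]]].

Definition homogeneous_product M n (h : 'I_n -> T) x :=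
  [/\ (0 < n)%N, (forall i, homogeneous M (h i))
    & x = \big[pmul M/pone M]_(i < n) h i].

Definition Hh M : pomonoid_data T := {|
  pset := [set x | exists n (h : 'I_n -> T), homogeneous_product M h x]
          `|` [set pone M];
  pmul := pmul M;
  pone := pone M;
  ple := ple M
|}.

Definition semi_homogeneous M :=
  [/\ is_pomonoid M, directed M, conic M
    & forall x, pset M x -> plt M (pone M) x ->
        exists n (h : 'I_n -> T), homogeneous_product M h x].

Definition disjoint_factorization M n (h : 'I_n -> T) x :=
  homogeneous_product M h x /\
  forall i j, i != j -> disjoint_elements M (h i) (h j).

Definition v_factorial M :=
  semi_homogeneous M /\
  forall x, pset M x -> plt M (pone M) x ->
    (exists n (h : 'I_n -> T), disjoint_factorization M h x) /\
    (forall n (h : 'I_n -> T) m (k : 'I_m -> T),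
       disjoint_factorization M h x -> disjoint_factorization M k x ->
       exists2 s : 'I_n -> 'I_m, bijective s & forall i, h i = k (s i)).

End POMonoid.


Section StarOperation.
Context {D : idomainType}.
Local Notation K := {fraction D}.
Local Notation "d %:F" := (@FracField.tofrac D d).
Implicit Types (I J : set K) (star : set K -> set K).

Definition integers : set K := range (@FracField.tofrac D).

Definition fractional_ideal I :=
  [/\ I 0,
      (forall x y, I x -> I y -> I (x + y)),
      (forall (d : D) x, I x -> I (d%:F * x)),
      (exists2 x, I x & x != 0)
    & exists2 d : D, d != 0 & forall x, I x -> integers (d%:F * x)].

Definition span n (g : 'I_n -> K) : set K :=
  [set \sum_(i < n) (c i)%:F * g i | c in [set: 'I_n -> D]].

Definition fg_fractional_ideal I :=
  fractional_ideal I /\ exists n (g : 'I_n -> K), I = span g.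

Definition principal (x : K) : set K := [set d%:F * x | d in [set: D]].

Definition scale_ideal (x : K) I : set K := [set x * y | y in I].

Definition add_ideal I J : set K := [set x + y | x in I & y in J].

Definition mul_ideal I J : set K :=
  [set z | exists n (a b : 'I_n -> K),
    [/\ forall i, I (a i), forall i, J (b i) & z = \sum_(i < n) a i * b i]].

(* A star operation is a map on the nonzero fractional ideals: the values of [star] on other subsets of
   the quotient field are unconstrained and never used. *)
Record star_operation star : Prop := StarOperation {
  star_fractional : forall I, fractional_ideal I -> fractional_ideal (star I);
  star_principal : forall x : K, x != 0 -> star (principal x) = principal x;
  star_scale : forall (x : K) I, x != 0 -> fractional_ideal I ->
    star (scale_ideal x I) = scale_ideal x (star I);
  star_ext : forall I, fractional_ideal I -> I `<=` star I;
  star_mono : forall I J, fractional_ideal I -> fractional_ideal J ->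
    I `<=` J -> star I `<=` star J;
  star_idem : forall I, fractional_ideal I -> star (star I) = star I
}.

Definition finite_character star := forall I, fractional_ideal I ->
  star I = \bigcup_(J in [set J | fg_fractional_ideal J /\ J `<=` I]) star J.

Definition star_mul star I J := star (mul_ideal I J).

Definition finite_type_star_ideal star I :=
  fractional_ideal I /\ exists2 J, fg_fractional_ideal J & I = star J.

Definition phi star : pomonoid_data (set K) := {|
  pset := [set I | finite_type_star_ideal star I /\ I `<=` integers];
  pmul := star_mul star;
  pone := integers;
  ple := fun I J => J `<=` I
|}.

Definition homogeneous_ideal star : set (set K) := [set h |
  [/\ pset (phi star) h, h <> integers &
    forall j k, pset (phi star) j -> pset (phi star) k ->
      j <> integers -> k <> integers -> h `<=` j -> h `<=` k ->
      star (add_ideal j k) <> integers]].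

Definition star_SH star := forall d : D, d != 0 -> principal d%:F <> integers ->
  exists n (h : 'I_n -> set K),
    [/\ (0 < n)%N, forall i, homogeneous_ideal star (h i)
      & principal d%:F = \big[star_mul star/integers]_(i < n) h i].

End StarOperation.
Arguments integers D : clear implicits.

(* Main.v *)
Require Import Defs.
From mathcomp Require Import all_boot all_order all_algebra.
From mathcomp Require Import fraction.
From mathcomp Require Import boolp classical_sets functions.

(** In [phi star] every two elements have a meet, [(I + J)^star], and
    multiplication distributes over it because
    [L (I + J) = L I + L J] and closures may be taken at any stage
    ([star_mulr], [star_add]).  Everything else is a formal consequence of
    these two facts, so the argument lives in an arbitrary p.o. monoid with
    least element [e], binary meets, and distributivity: a meet monoid.

    The pre-Riesz property and smoothness come from the existence of meets, the
    meet of finitely many elements being the required common lower bound.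

    Write [x # y] for [x /\ y = e], and say that [x] meets [y] otherwise.
    Distributivity replaces cancellation
    through a Gauss lemma: [u # x] and [u <= x y] give [u <= y]
    ([disj_cancel]), since [y = (u /\ x) y = u y /\ x y].  On homogeneous
    elements, not being disjoint is an equivalence relation ([hom_trans]), and
    by the Gauss lemma the product of two equivalent homogeneous elements is
    again homogeneous ([hom_mul]).  Merging equivalent factors turns any product
    of homogeneous elements into a product of mutually disjoint ones
    ([Hh_disjoint]).  Such a factorization is unique: a factor [h] of one
    factorization meets exactly one factor [k] of another, and the Gauss lemma,
    applied to the other factors, gives [h <= k] and [k <= h].

    The elements below a product of homogeneous elements are again such
    products ([Hh_down]): if [y # z] and [x <= y z], then
    [x = (x /\ y) (x /\ z)] ([meet_mul_disj]), and a nontrivial element below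
    a homogeneous one is homogeneous.  This has two consequences.  A meet monoid
    in which every element lies below a product of homogeneous elements is
    v-factorial ([meet_monoid_v_factorial]); for [phi star] of a star-SH domain
    this applies because an ideal [I] lies below every nonzero principal
    ideal it contains.  And [Hh M] is itself a meet monoid, being a
    down-closed submonoid, so the same criterion applies to it. *)

Set Implicit Arguments.
Unset Strict Implicit.
Unset Printing Implicit Defensive.

Import GRing.Theory.
Local Open Scope ring_scope.
Local Open Scope classical_set_scope.

(** * Meet monoids *)

(** The meet is carried as a function here, so that computations with it are
    equational; [is_meet] makes the choice unique. *)
Record is_meet_monoid T (M : pomonoid_data T) (meet : T -> T -> T) : Prop :=
IsMeetMonoid {
  mm_pomonoid : is_pomonoid M;
  mm_least : forall x, pset M x -> ple M (pone M) x;
  mm_meet : forall x y, pset M x -> pset M y -> is_meet M x y (meet x y);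
  mm_distr : forall x y z, pset M x -> pset M y -> pset M z ->
    pmul M z (meet x y) = meet (pmul M z x) (pmul M z y)
}.

Definition fun_cons T n (a : T) (h : 'I_n -> T) (i : 'I_n.+1) : T :=
  oapp h a (unlift ord0 i).

Lemma fun_cons0 T n (a : T) (h : 'I_n -> T) : fun_cons a h ord0 = a.
Proof. by rewrite /fun_cons unlift_none. Qed.

Lemma fun_consS T n (a : T) (h : 'I_n -> T) i :
  fun_cons a h (lift ord0 i) = h i.
Proof. by rewrite /fun_cons liftK. Qed.

Lemma big_fun_cons T (op : T -> T -> T) (x0 : T) n (a : T) (h : 'I_n -> T) :
  \big[op/x0]_(i < n.+1) fun_cons a h i = op a (\big[op/x0]_(i < n) h i).
Proof.
rewrite big_ord_recl fun_cons0; congr (op _ _).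
by apply: eq_bigr => i _; rewrite fun_consS.
Qed.

Lemma fun_consP T n (P : T -> Prop) (a : T) (h : 'I_n -> T) :
  P a -> (forall i, P (h i)) -> forall i, P (fun_cons a h i).
Proof.
move=> Pa Ph i; case: (unliftP ord0 i) => [j|] ->.
  by rewrite fun_consS.
by rewrite fun_cons0.
Qed.

Section MeetMonoid.
Context {T : Type} {M : pomonoid_data T} {meet : T -> T -> T}.
Hypothesis MM : is_meet_monoid M meet.

Local Notation e := (pone M).
Local Notation "x <*> y" := (pmul M x y) (at level 40, left associativity).
Local Notation "x <&> y" := (meet x y) (at level 45, left associativity).
Local Notation "x <<= y" := (ple M x y) (at level 70).
Local Notation "x # y" := (x <&> y = e) (at level 70).

Let PM : is_pomonoid M := mm_pomonoid MM.

Let one_in : pset M e. Proof. exact: pone_in PM. Qed.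
Let mul_in x y : pset M x -> pset M y -> pset M (x <*> y).
Proof. exact: pmul_in PM x y. Qed.
Let meet_in x y : pset M x -> pset M y -> pset M (x <&> y).
Proof. by move=> Mx My; have [[]] := mm_meet MM Mx My. Qed.

#[local] Hint Resolve one_in mul_in meet_in : core.

Lemma mul_e x : pset M x -> x <*> e = x.
Proof. by move=> Mx; rewrite (pmulC PM) ?(pmul1 PM). Qed.

Lemma meet_lel x y : pset M x -> pset M y -> x <&> y <<= x.
Proof. by move=> Mx My; have [[_ lb] _] := mm_meet MM Mx My; apply: lb; left. Qed.

Lemma meet_ler x y : pset M x -> pset M y -> x <&> y <<= y.
Proof. by move=> Mx My; have [[_ lb] _] := mm_meet MM Mx My; apply: lb; right. Qed.

Lemma meet_glb x y z : pset M x -> pset M y -> pset M z ->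
  z <<= x -> z <<= y -> z <<= x <&> y.
Proof.
move=> Mx My Mz zx zy; have [_ glb] := mm_meet MM Mx My.
by apply: glb; split=> // _ [] ->.
Qed.

Lemma le_e x : pset M x -> x <<= e -> x = e.
Proof. by move=> Mx xe; apply: (ple_anti PM) => //; apply: (mm_least MM). Qed.

Lemma lt_eP x : pset M x -> plt M e x <-> x <> e.
Proof.
move=> Mx; split=> [[_ ne] xe|ne]; first by apply: ne.
by split; [apply: (mm_least MM)|move=> ex; apply: ne].
Qed.

Lemma le_mulr x y : pset M x -> pset M y -> x <<= x <*> y.
Proof.
move=> Mx My; rewrite -{1}(mul_e Mx); apply: (ple_mul PM) => //.
exact: (mm_least MM).
Qed.

Lemma le_mull x y : pset M x -> pset M y -> x <<= y <*> x.
Proof. by move=> Mx My; rewrite (pmulC PM) //; apply: le_mulr. Qed.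

Lemma le_mul2 x y x' y' : pset M x -> pset M y -> pset M x' -> pset M y' ->
  x <<= x' -> y <<= y' -> x <*> y <<= x' <*> y'.
Proof.
move=> Mx My Mx' My' xx' yy'; apply: (ple_trans PM (y := x <*> y')); auto.
  exact: (ple_mul PM).
by rewrite ![_ <*> y'](pmulC PM) //; apply: (ple_mul PM).
Qed.

Lemma meetC x y : pset M x -> pset M y -> x <&> y = y <&> x.
Proof.
move=> Mx My; apply: (ple_anti PM); auto;
  by apply: meet_glb; auto using meet_lel, meet_ler.
Qed.

Lemma is_meet_eq x y w : pset M x -> pset M y -> is_meet M x y w -> w = x <&> y.
Proof.
move=> Mx My [[Mw lbw] glbw]; have [lb glb] := mm_meet MM Mx My.
by apply: (ple_anti PM) => //; [apply: meet_in | apply: glb | apply: glbw].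
Qed.

Lemma disjointP x y : pset M x -> pset M y -> disjoint_elements M x y <-> x # y.
Proof.
move=> Mx My; split=> [/(is_meet_eq Mx My)|xy] //.
by rewrite /disjoint_elements -xy; apply: (mm_meet MM).
Qed.

Lemma disj_le x y u : pset M x -> pset M y -> pset M u ->
  x # y -> u <<= x -> u # y.
Proof.
move=> Mx My Mu xy ux; apply: le_e; first by auto.
rewrite -xy; apply: meet_glb; auto; last exact: meet_ler.
by apply: (ple_trans PM) ux; auto using meet_lel.
Qed.

Lemma meet_neq_e x y l : pset M x -> pset M y -> pset M l ->
  l <> e -> l <<= x -> l <<= y -> ~ x # y.
Proof.
move=> Mx My Ml le lx ly xy; apply: le; apply: le_e => //.
by rewrite -xy; apply: meet_glb.
Qed.

(** Gauss lemma.  Distributivity does the work of cancellation: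
    [y = e y = (u /\ x) y = u y /\ x y], and [u] is below both terms. *)
Lemma disj_cancel u x y : pset M u -> pset M x -> pset M y ->
  u # x -> u <<= x <*> y -> u <<= y.
Proof.
move=> Mu Mx My ux uxy; rewrite -(mul_e My) -ux (mm_distr MM) //.
apply: meet_glb; auto; first exact: le_mull.
by rewrite (pmulC PM).
Qed.

(** [w = u /\ x y] is disjoint from [x], so by the Gauss lemma it lies below
    [y], hence below [u /\ y = e]. *)
Lemma disj_mul u x y : pset M u -> pset M x -> pset M y ->
  u # x -> u # y -> u # (x <*> y).
Proof.
move=> Mu Mx My ux uy; apply: le_e; auto.
have wu : u <&> (x <*> y) <<= u by apply: meet_lel; auto.
rewrite -uy; apply: meet_glb; auto.
apply: (@disj_cancel _ x); auto; last by apply: meet_ler; auto.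
by apply: disj_le wu; auto.
Qed.

(** The product expands to [x x /\ x y /\ x z /\ y z], and [x] is below all
    four terms.  Conversely, the two middle ones have meet
    [x (y /\ z) = x]. *)
Lemma meet_mul_disj x y z : pset M x -> pset M y -> pset M z ->
  y # z -> x <<= y <*> z -> x = (x <&> y) <*> (x <&> z).
Proof.
move=> Mx My Mz yz xyz.
have xy_in := meet_in Mx My; have xz_in := meet_in Mx Mz.
apply: (ple_anti PM); auto.
  rewrite (mm_distr MM) //; apply: meet_glb; auto; first exact: le_mull.
  rewrite (pmulC PM) // (mm_distr MM) //; apply: meet_glb; auto.
    exact: le_mull.
  by rewrite (pmulC PM).
suff: (x <&> y) <*> (x <&> z) <<= x <*> (y <&> z) by rewrite yz mul_e.
rewrite [x <*> (y <&> z)](mm_distr MM) //; apply: meet_glb; auto.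
  by rewrite (pmulC PM) //; apply: le_mul2; auto using meet_lel, meet_ler.
by apply: le_mul2; auto using meet_lel, meet_ler.
Qed.

(** * The pre-Riesz and smoothness properties *)

Lemma finite_glb n (x : 'I_n.+1 -> T) : (forall i, pset M (x i)) ->
  exists g, is_glb M (range x) g.
Proof.
elim: n x => [|n IHn] x Mx.
  exists (x ord0); split; first split=> //.
    by move=> _ [i _ <-]; rewrite (ord1 i); apply: (ple_refl PM).
  by move=> l [_]; apply; exists ord0.
have [g [[Mg lb] glb]] := IHn (x \o lift ord0) (fun i => Mx _).
exists (x ord0 <&> g); split; first split; auto.
  move=> _ [i _ <-]; case: (unliftP ord0 i) => [j|] ->; last exact: meet_lel.
  apply: (ple_trans PM (y := g)) => //; first exact: meet_in.
    exact: meet_ler.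
  by apply: lb; exists j.
move=> l [Ml ll]; apply: meet_glb => //; first by apply: ll; exists ord0.
by apply: glb; split=> // _ [j _ <-]; apply: ll; exists (lift ord0 j).
Qed.

Lemma meet_monoid_directed : directed M.
Proof.
move=> x y Mx My; split.
  by exists (x <*> y); split; auto using le_mulr, le_mull.
by exists e; split=> //; apply: (mm_least MM).
Qed.

Lemma meet_monoid_conic : conic M.
Proof.
move=> x y Mx My xy; split; apply: le_e => //; rewrite -xy.
  exact: le_mulr.
exact: le_mull.
Qed.

Lemma meet_monoid_pre_Riesz : pre_Riesz M.
Proof.
split=> //; [exact: meet_monoid_directed | exact: (mm_least MM) |].
move=> n x Mx; have [g gP] := finite_glb (fun i => (Mx i).1).
have [ge|ge] := EM (g = e); first by left; rewrite -ge.
have [[Mg lb] _] := gP; right; exists g; split=> //; first exact/lt_eP.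
by move=> i; apply: lb; exists i.
Qed.

Lemma meet_monoid_smooth : meet_smooth M.
Proof.
split=> [x y w Mx My /(is_meet_eq Mx My) -> z Mz|x y z w Mx My Mz].
  by rewrite (mm_distr MM) //; apply: (mm_meet MM); auto.
have meetA : x <&> (y <&> z) = (x <&> y) <&> z.
  apply: (ple_anti PM); auto; repeat apply: meet_glb; auto using meet_lel, meet_ler.
  - by apply: (ple_trans PM (y := y <&> z)); auto using meet_lel, meet_ler.
  - by apply: (ple_trans PM (y := y <&> z)); auto using meet_lel, meet_ler.
  - by apply: (ple_trans PM (y := x <&> y)); auto using meet_lel, meet_ler.
  - by apply: (ple_trans PM (y := x <&> y)); auto using meet_lel, meet_ler.
split=> [[u /is_meet_eq -> //]|[u /is_meet_eq -> //]] /is_meet_eq ->; auto.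
  exists (x <&> y); first exact: (mm_meet MM).
  by rewrite meetA; apply: (mm_meet MM); auto.
exists (y <&> z); first exact: (mm_meet MM).
by rewrite -meetA; apply: (mm_meet MM); auto.
Qed.

(** * Homogeneous elements *)

(** The meet is the largest candidate for the common lower bound [l], so
    homogeneity says that no two nontrivial elements below [h] are disjoint. *)
Lemma homogeneousP h : homogeneous M h <->
  [/\ pset M h, h <> e & forall u v, pset M u -> pset M v ->
     u <> e -> v <> e -> u <<= h -> v <<= h -> ~ u # v].
Proof.
split=> [[Mh eh H]|[Mh eh H]]; split=> //.
- exact/lt_eP.
- move=> u v Mu Mv ue ve uh vh.
  have [||l [Ml le lu lv]] := H u v Mu Mv _ uh _ vh; try exact/lt_eP.
  by apply: (@meet_neq_e u v l) => //; apply/lt_eP.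
- exact/lt_eP.
- move=> u v Mu Mv /lt_eP ue uh /lt_eP ve vh; exists (u <&> v).
  split; auto using meet_lel, meet_ler.
  by apply/lt_eP; auto.
Qed.

Lemma hom_in h : homogeneous M h -> pset M h.
Proof. by case. Qed.

#[local] Hint Resolve hom_in : core.

Lemma hom_neq h : homogeneous M h -> h <> e.
Proof. by case/homogeneousP. Qed.

Lemma hom_down h u : homogeneous M h -> pset M u -> u <> e -> u <<= h ->
  homogeneous M u.
Proof.
move=> /homogeneousP[Mh he H] Mu ue uh; apply/homogeneousP; split=> //.
move=> v w Mv Mw ve we vu wu.
by apply: H => //; apply: (ple_trans PM (y := u)).
Qed.

(** Transitivity of non-disjointness through a homogeneous [h]: both
    [x /\ h] and [h /\ y] are nontrivial below [h], hence not disjoint. *)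
Lemma hom_trans h x y : homogeneous M h -> pset M x -> pset M y ->
  ~ x # h -> ~ h # y -> ~ x # y.
Proof.
move=> hom_h Mx My xh hy; have Mh := hom_in hom_h.
have /homogeneousP[_ _ /(_ (x <&> h) (h <&> y))] := hom_h.
move=> /(_ _ _ xh hy) ne xy; apply: ne; auto using meet_lel, meet_ler.
apply: (@disj_le x _ (x <&> h)); auto using meet_lel.
rewrite meetC; auto; apply: (@disj_le y); auto using meet_ler.
by rewrite meetC.
Qed.

(** Every nontrivial [u <= h k] meets [h]: otherwise [u <= k] by the Gauss
    lemma, so that [u] meets [k] and, through [k], also [h].  Two such elements
    therefore meet each other, through [h]. *)
Lemma hom_mul h k : homogeneous M h -> homogeneous M k -> ~ h # k ->
  homogeneous M (h <*> k).
Proof.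
move=> hom_h hom_k hk; have Mh := hom_in hom_h; have Mk := hom_in hom_k.
have touch u : pset M u -> u <> e -> u <<= h <*> k -> ~ u # h.
  move=> Mu ue uhk uh; apply: (@hom_trans k u h); auto; last by rewrite meetC.
  have uk := disj_cancel Mu Mh Mk uh uhk.
  by apply: (@meet_neq_e _ _ u) => //; apply: (ple_refl PM).
apply/homogeneousP; split; auto.
  by move=> hke; apply: hk; have [-> ->] := meet_monoid_conic Mh Mk hke;
    apply: le_e; auto using meet_lel.
move=> u v Mu Mv ue ve uhk vhk; apply: (@hom_trans h); auto.
by rewrite meetC //; apply: touch.
Qed.

(** * Products of families of pairwise disjoint elements *)

Local Notation prod h := (\big[pmul M/pone M]_i h i).

Lemma prod_in n (h : 'I_n -> T) : (forall i, pset M (h i)) -> pset M (prod h).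
Proof. by move=> Mh; apply: big_ind; auto. Qed.

Lemma disj_prod n (h : 'I_n -> T) u : pset M u -> (forall i, pset M (h i)) ->
  (forall i, u # h i) -> u # prod h.
Proof.
move=> Mu Mh uh.
have [//] : pset M (prod h) /\ u # prod h.
apply: (big_ind (fun z => pset M z /\ u # z)); auto.
- by split=> //; apply: le_e; auto using meet_ler.
- by move=> x y [Mx ux] [My uy]; split; auto using disj_mul.
Qed.

(** The Gauss lemma, applied to every factor but one. *)
Lemma le_prod_disj n (h : 'I_n -> T) u i : pset M u ->
  (forall j, pset M (h j)) -> (forall j, j != i -> u # h j) ->
  u <<= prod h -> u <<= h i.
Proof.
move=> Mu; elim: n h i => [|n IHn] h i Mh uh; first by case: i uh.
rewrite big_ord_recl; have Mt := prod_in (fun j => Mh (lift ord0 j)).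
case: (unliftP ord0 i) uh => [j|] -> uh ule.
  apply: (IHn (h \o lift ord0)) => /= [k|k kj|]; first exact: Mh.
    by apply: uh; rewrite (inj_eq lift_inj).
  by apply: disj_cancel ule => //; apply: uh.
apply: (@disj_cancel _ (prod (h \o lift ord0))) => //.
  by apply: disj_prod => //= j; apply: uh.
by rewrite (pmulC PM).
Qed.

Lemma prod_factor_le n (h : 'I_n -> T) i : (forall j, pset M (h j)) ->
  h i <<= prod h.
Proof.
elim: n h i => [|n IHn] h i Mh; first by case: i.
rewrite big_ord_recl; have Mt := prod_in (fun j => Mh (lift ord0 j)).
case: (unliftP ord0 i) => [j|] ->; last exact: le_mulr.
apply: (ple_trans PM) (IHn (h \o lift ord0) j (fun=> Mh _)) _ => //.
- exact: (Mh (lift ord0 j)).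
- exact: mul_in.
- exact: le_mull.
Qed.

(** The empty product accounts for the identity, so that one form covers both
    parts of [Hh]. *)
Lemma HhP x : pset (Hh M) x <->
  exists n (h : 'I_n -> T), (forall i, homogeneous M (h i)) /\ x = prod h.
Proof.
split=> [[[n [h [_ Mh ->]]]|->]|[[|n] [h [Mh ->]]]].
- by exists n, h.
- exists 0%N, (fun=> e); split; first by case.
  by rewrite big_ord0.
- by right; rewrite big_ord0.
- by left; exists n.+1, h; split.
Qed.

Lemma Hh_in x : pset (Hh M) x -> pset M x.
Proof. by case/HhP=> n [h [hh ->]]; apply: prod_in; auto. Qed.

Lemma Hh_cons h x : homogeneous M h -> pset (Hh M) x -> pset (Hh M) (h <*> x).
Proof.
move=> hom_h /HhP[n [k [hk ->]]]; apply/HhP; exists n.+1, (fun_cons h k).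
by split; [apply: fun_consP|rewrite big_fun_cons].
Qed.

Lemma Hh_mul x y : pset (Hh M) x -> pset (Hh M) y -> pset (Hh M) (x <*> y).
Proof.
move=> /HhP[n [h [hh ->]]] Hy.
elim: n h hh => [|n IHn] h hh.
  by rewrite big_ord0 (pmul1 PM) //; apply: Hh_in.
rewrite big_ord_recl -(pmulA PM); auto using Hh_in; last by apply: prod_in; auto.
by apply: Hh_cons => //; apply: IHn.
Qed.

Lemma hom_Hh h : homogeneous M h -> pset (Hh M) h.
Proof.
by move=> hom_h; rewrite -(mul_e (hom_in hom_h)); apply: Hh_cons => //; right.
Qed.

Lemma disjoint_cons n (h : 'I_n -> T) k :
  homogeneous M k -> (forall i, homogeneous M (h i)) ->
  (forall i, k # h i) -> (forall i j, i != j -> h i # h j) ->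
  forall i j, i != j -> fun_cons k h i # fun_cons k h j.
Proof.
move=> hk hh kh dh i j.
case: (unliftP ord0 i) => [i'|] ->; case: (unliftP ord0 j) => [j'|] ->;
  rewrite ?fun_consS ?fun_cons0 ?eqxx //.
- by rewrite (inj_eq lift_inj); apply: dh.
- by move=> _; rewrite meetC; auto.
Qed.

(** Either [k] meets some factor, which then absorbs it, or it becomes a new
    factor.  The last clause says that no element disjoint from all the
    old factors can meet a new one; the induction needs it to keep the head of
    the family disjoint from the updated tail. *)
Lemma insert_disjoint n (h : 'I_n -> T) k :
  (forall i, homogeneous M (h i)) -> (forall i j, i != j -> h i # h j) ->
  homogeneous M k ->
  exists m (h' : 'I_m -> T),
    [/\ (forall i, homogeneous M (h' i)),
        (forall i j, i != j -> h' i # h' j),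
        prod h' = k <*> prod h
      & forall l, pset M l -> l # k -> (forall i, l # h i) ->
          forall i, l # h' i].
Proof.
elim: n h k => [|n IHn] h k hh dh hk.
  exists 1%N, (fun_cons k h); split.
  - exact: fun_consP.
  - by move=> i j; rewrite !ord1.
  - by rewrite big_fun_cons.
  - by move=> l Ml lk lh; apply: (fun_consP (P := fun z => l # z)).
pose t := h \o lift ord0.
have ht i : homogeneous M (t i) by apply: hh.
have Mt : pset M (prod t) by apply: prod_in; auto.
have h0t i : h ord0 # t i by apply: dh; rewrite eq_sym lift_eqF.
have dt i j : i != j -> t i # t j by move=> ij; apply: dh; rewrite (inj_eq lift_inj).
have [k0|k0] := EM (k # h ord0); last first.
  (* The head absorbs k.  It stays disjoint from a tail factor, since one that
     meets k would meet the head, through k. *)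
  exists n.+1, (fun_cons (k <*> h ord0) t).
  have hk0 : homogeneous M (k <*> h ord0) by apply: hom_mul.
  split.
  - exact: fun_consP.
  - apply: disjoint_cons => // i; rewrite meetC; auto; apply: disj_mul; auto.
      apply: contrapT => tk; apply: (@hom_trans k (t i) (h ord0)); auto.
      by rewrite meetC; auto.
    by rewrite meetC; auto.
  - by rewrite big_fun_cons big_ord_recl (pmulA PM); auto.
  - move=> l Ml lk lh; apply: (fun_consP (P := fun z => l # z)).
      by apply: disj_mul; auto.
    by move=> i; apply: lh.
have [m [h' [hh' dh' eh' lh']]] := IHn t k ht dt hk.
exists m.+1, (fun_cons (h ord0) h'); split.
- exact: fun_consP.
- apply: disjoint_cons => // i.
  by apply: lh'; auto; rewrite meetC; auto.
- rewrite big_fun_cons eh' big_ord_recl !(pmulA PM); auto.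
  by rewrite [h ord0 <*> k](pmulC PM); auto.
- move=> l Ml lk lh; apply: (fun_consP (P := fun z => l # z)) => //.
  by apply: lh' => // i; apply: lh.
Qed.

Lemma Hh_disjoint x : pset (Hh M) x -> exists n (h : 'I_n -> T),
  [/\ (forall i, homogeneous M (h i)), (forall i j, i != j -> h i # h j)
    & x = prod h].
Proof.
move=> /HhP[n [h [hh ->]]]; elim: n h hh => [|n IHn] h hh.
  by exists 0%N, h; split=> // -[].
have [m [k [hk dk ek]]] := IHn (h \o lift ord0) (fun i => hh _).
have [p [k' [hk' dk' ek' _]]] := insert_disjoint hk dk (hh ord0).
by exists p, k'; split=> //; rewrite ek' big_ord_recl -ek.
Qed.

(** By [meet_mul_disj] along a disjoint factorization [y = h_1 .. h_n], the
    element [x] is the product of the [x /\ h_i], each of which is trivial or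
    homogeneous. *)
Lemma Hh_down x y : pset M x -> pset (Hh M) y -> x <<= y -> pset (Hh M) x.
Proof.
move=> Mx /Hh_disjoint[n [h [hh dh ->]]].
elim: n h hh dh x Mx => [|n IHn] h hh dh x Mx.
  by rewrite big_ord0 => /(le_e Mx) ->; right.
rewrite big_ord_recl => xle.
pose t := h \o lift ord0.
have ht i : homogeneous M (t i) by apply: hh.
have dt i j : i != j -> t i # t j by move=> ij; apply: dh; rewrite (inj_eq lift_inj).
have Mt : pset M (prod t) by apply: prod_in; auto.
have h0t : h ord0 # prod t.
  by apply: disj_prod; auto => i; apply: dh; rewrite eq_sym lift_eqF.
rewrite (meet_mul_disj Mx _ Mt h0t xle); auto; apply: Hh_mul.
  have [->|ne] := EM (x # h ord0); first by right.
  by apply: hom_Hh; apply: (@hom_down (h ord0)); auto using meet_ler.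
by apply: (IHn t); auto using meet_ler.
Qed.

(** Some [k j] meets [h i], as [h i] lies below the product of the [k j].  By
    transitivity [h i] is disjoint from the other [k a], and [k j] from the
    other [h a], so the Gauss lemma gives both inequalities. *)
Lemma disjoint_factorization_match x n (h : 'I_n -> T) m (k : 'I_m -> T) i :
  disjoint_factorization M h x -> disjoint_factorization M k x ->
  exists j, h i = k j.
Proof.
move=> [[_ hh ex] dh] [[_ hk ex'] dk].
have Mh j : pset M (h j) by auto.
have Mk j : pset M (k j) by auto.
have dh' a b : a != b -> h a # h b by move=> ab; apply/disjointP; auto.
have dk' a b : a != b -> k a # k b by move=> ab; apply/disjointP; auto.
have hx a : h a <<= prod k by rewrite -ex' ex; apply: prod_factor_le.
have kx a : k a <<= prod h by rewrite -ex ex'; apply: prod_factor_le.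
have [j hkj] : exists j, ~ h i # k j.
  apply: contrapT => /forallNP none; apply: (hom_neq (hh i)).
  have hi_prod : h i # prod k.
    by apply: disj_prod => // j; apply: contrapT; apply: none.
  by apply: le_e => //; rewrite -hi_prod; apply: meet_glb; auto;
    [apply: prod_in | apply: (ple_refl PM)].
exists j; apply: (ple_anti PM) => //.
  apply: le_prod_disj => // a aj; apply: contrapT => hka.
  apply: (@hom_trans (h i) (k a) (k j)); auto.
  by rewrite meetC.
apply: le_prod_disj => // a ai; apply: contrapT => kha.
by apply: (@hom_trans (k j) (h i) (h a)); auto; apply: dh'; rewrite eq_sym.
Qed.

Lemma disjoint_factorization_inj x n (h : 'I_n -> T) :
  disjoint_factorization M h x -> injective h.
Proof.
move=> [[_ hh _] dh] i j hij; apply: contrapT => /eqP ij.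
have Mi := hom_in (hh i).
apply: (@meet_neq_e (h i) (h j) (h i)); rewrite -?hij; auto using (ple_refl PM).
  exact: hom_neq.
by rewrite {2}hij; apply/disjointP; auto.
Qed.

Lemma disjoint_factorization_unique x n (h : 'I_n -> T) m (k : 'I_m -> T) :
  disjoint_factorization M h x -> disjoint_factorization M k x ->
  exists2 s : 'I_n -> 'I_m, bijective s & forall i, h i = k (s i).
Proof.
move=> fh fk.
have [s hs] := choice (fun i => disjoint_factorization_match i fh fk).
have [t kt] := choice (fun j => disjoint_factorization_match j fk fh).
exists s => //; exists t => [i|j].
  by apply: (disjoint_factorization_inj fh); rewrite -kt -hs.
by apply: (disjoint_factorization_inj fk); rewrite -hs -kt.
Qed.

(** By [Hh_down] the domination hypothesis already makes every element a
    product of homogeneous ones.  It has this form because in [phi star] one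
    knows only that the principal ideals, which are cofinal, factor. *)
Lemma meet_monoid_v_factorial :
  (forall x, pset M x -> x <> e -> exists2 y, pset (Hh M) y & x <<= y) ->
  v_factorial M.
Proof.
move=> dominated.
have inHh x : pset M x -> plt M e x -> pset (Hh M) x.
  move=> Mx /lt_eP xe; have [//|y Hy xy] := dominated x Mx.
    exact: xe.
  exact: Hh_down xy.
split=> [|x Mx xe].
  split=> //; [exact: meet_monoid_directed | exact: meet_monoid_conic |].
  by move=> x Mx xe; have [//|xe'] := inHh x Mx xe; case: xe => _ []; rewrite xe'.
split; last by move=> n h m k; apply: disjoint_factorization_unique.
have [n [h [hh dh ex]]] := Hh_disjoint (inHh x Mx xe).
exists n, h; split; last by move=> i j ij; apply/disjointP; auto.
split=> //; case: n h hh dh ex => // h _ _ ex.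
by case: xe => _ []; rewrite ex big_ord0.
Qed.

(** Down-closure puts the meets of [M] inside [Hh M]. *)
Lemma Hh_meet_monoid : is_meet_monoid (Hh M) meet.
Proof.
split=> /=.
- split=> /=; first by right.
  + exact: Hh_mul.
  + by move=> x y z /Hh_in Mx /Hh_in My /Hh_in Mz; apply: (pmulA PM).
  + by move=> x y /Hh_in Mx /Hh_in My; apply: (pmulC PM).
  + by move=> x /Hh_in Mx; apply: (pmul1 PM).
  + by move=> x /Hh_in Mx; apply: (ple_refl PM).
  + by move=> x y /Hh_in Mx /Hh_in My; apply: (ple_anti PM).
  + by move=> x y z /Hh_in Mx /Hh_in My /Hh_in Mz; apply: (ple_trans PM).
  + by move=> x y z /Hh_in Mx /Hh_in My /Hh_in Mz; apply: (ple_mul PM).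
- by move=> x /Hh_in; apply: (mm_least MM).
- move=> x y Hx Hy; have Mx := Hh_in Hx; have My := Hh_in Hy.
  have [[Mw lb] glb] := mm_meet MM Mx My.
  split; last by move=> l [/Hh_in Ml ll]; apply: glb.
  by split=> //; apply: Hh_down Hx _; auto using meet_lel.
- by move=> x y z /Hh_in Mx /Hh_in My /Hh_in Mz; apply: (mm_distr MM).
Qed.

(** The common lower bound [l] lies in [Hh M], again by down-closure. *)
Lemma hom_Hh_hom h : homogeneous M h -> homogeneous (Hh M) h.
Proof.
move=> hom_h; have [Mh eh H] := hom_h; split=> //; first exact: hom_Hh.
move=> u v Hu Hv ue uh ve vh.
have [l [Ml el lu lv]] := H u v (Hh_in Hu) (Hh_in Hv) ue uh ve vh.
by exists l; split=> //; apply: Hh_down Hu lu.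
Qed.

End MeetMonoid.

Lemma Hh_v_factorial T (M : pomonoid_data T) meet :
  is_meet_monoid M meet -> v_factorial (Hh M).
Proof.
move=> MM; apply: (meet_monoid_v_factorial (Hh_meet_monoid MM)) => x Hx _.
exists x; last by apply: (ple_refl (mm_pomonoid MM)); apply: (Hh_in MM).
have /HhP[n [h [hh ->]]] := Hx; apply/HhP.
by exists n, h; split=> // i; apply: (hom_Hh_hom MM).
Qed.

(** * Fractional ideals *)

Section Ideals.
Context {D : idomainType}.
Local Notation K := {fraction D}.
Local Notation span := Defs.span.
Local Notation "d %:F" := (@FracField.tofrac D d).
Implicit Types (I J L N : set K).

(** Sub-D-modules of [K].  Inclusions out of products, sums and spans are tested
    on generators against such targets, which include spans not yet known to
    be nonzero. *)
Definition submodule N :=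
  [/\ N 0, (forall x y, N x -> N y -> N (x + y))
    & (forall (d : D) x, N x -> N (d%:F * x))].

Lemma fractional_submodule I : fractional_ideal I -> submodule I.
Proof. by case. Qed.

Lemma fractional_sub I J : fractional_ideal J -> I `<=` J -> submodule I ->
  (exists2 x, I x & x != 0) -> fractional_ideal I.
Proof.
move=> [_ _ _ _ [d d0 dJ]] IJ [I0 ID IM] In0; split=> //.
by exists d => // x /IJ /dJ.
Qed.

Lemma submodule_sum N n (x : 'I_n -> K) : submodule N -> (forall i, N (x i)) ->
  N (\sum_(i < n) x i).
Proof. by move=> [N0 ND _] Nx; apply: big_ind. Qed.

Lemma integersP (d : D) : integers D d%:F. Proof. by exists d. Qed.

Lemma integersM x y : integers D x -> integers D y -> integers D (x * y).
Proof. by move=> [a _ <-] [b _ <-]; rewrite -rmorphM; apply: integersP. Qed.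

Lemma integers1 : integers D 1. Proof. by exists 1; rewrite ?rmorph1. Qed.

Lemma integers_principal : integers D = principal 1.
Proof.
by rewrite eqEsubset; split=> [_ [d _ <-]|_ [d _ <-]]; exists d; rewrite ?mulr1.
Qed.

Lemma fractional_integers : fractional_ideal (integers D).
Proof.
split.
- by exists 0; rewrite ?rmorph0.
- by move=> _ _ [a _ <-] [b _ <-]; rewrite -rmorphD; apply: integersP.
- by move=> d x; apply: integersM; apply: integersP.
- by exists 1; [exact: integers1|exact: oner_neq0].
- exists 1; first exact: oner_neq0.
  by move=> x; rewrite rmorph1 mul1r.
Qed.

Section Span.
Variables (n : nat) (g : 'I_n -> K).

Lemma span_submodule : submodule (span g).
Proof.
split=> [|_ _ [c _ <-] [d _ <-]|d _ [c _ <-]].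
- by exists (fun=> 0) => //; rewrite big1 // => i _; rewrite rmorph0 mul0r.
- exists (fun i => c i + d i) => //.
  by rewrite -big_split; apply: eq_bigr => i _; rewrite rmorphD mulrDl.
- exists (fun i => d * c i) => //.
  by rewrite mulr_sumr; apply: eq_bigr => i _; rewrite rmorphM mulrA.
Qed.

Lemma span_gen i : span g (g i).
Proof.
exists (fun j => (j == i)%:R) => //; rewrite (bigD1 i) //= eqxx rmorph1 mul1r.
by rewrite big1 ?addr0 // => j /negbTE ->; rewrite rmorph0 mul0r.
Qed.

Lemma span_sub N : submodule N -> (forall i, N (g i)) -> span g `<=` N.
Proof.
move=> sN Ng _ [c _ <-]; have [_ _ NM] := sN.
by apply: submodule_sum => // i; apply: NM.
Qed.

End Span.

Lemma principal_span (x : K) : principal x = span (fun _ : 'I_1 => x).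
Proof.
rewrite eqEsubset; split=> [_ [d _ <-]|_ [c _ <-]].
  by exists (fun=> d) => //; rewrite big_ord1.
by exists (c ord0) => //; rewrite big_ord1.
Qed.

Lemma principal_sub (x : K) N : submodule N -> N x -> principal x `<=` N.
Proof. by move=> [_ _ NM] Nx _ [d _ <-]; apply: NM. Qed.

Lemma fractional_principal (d : D) : d != 0 -> fractional_ideal (principal d%:F).
Proof.
move=> d0; apply: (fractional_sub fractional_integers).
- apply: principal_sub (integersP d).
  exact: fractional_submodule fractional_integers.
- by rewrite principal_span; apply: span_submodule.
- exists d%:F; last by rewrite tofrac_eq0.
  by exists 1; rewrite // rmorph1 mul1r.
Qed.

Lemma fg_principal (d : D) : d != 0 -> fg_fractional_ideal (principal d%:F).
Proof.
move=> d0; split; first exact: fractional_principal.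
by exists 1%N, (fun=> d%:F); exact: principal_span.
Qed.

(** Generators indexed by any finite type will do; minimality among submodules
    replaces the explicit coefficients of a span. *)
Lemma fg_finType (S : finType) (g : S -> K) I : fractional_ideal I ->
  (forall s, I (g s)) ->
  (forall N, submodule N -> (forall s, N (g s)) -> I `<=` N) ->
  fg_fractional_ideal I.
Proof.
move=> fI Ig Imin; split=> //; exists #|S|, (g \o enum_val).
rewrite eqEsubset; split; last first.
  by apply: span_sub => [|i]; [exact: fractional_submodule|exact: Ig].
apply: Imin; first exact: span_submodule.
by move=> s; rewrite -(enum_rankK s); apply: (span_gen (g \o enum_val)).
Qed.

Lemma mul_ideal_gen I J a b : I a -> J b -> mul_ideal I J (a * b).
Proof.
by move=> Ia Jb; exists 1%N, (fun=> a), (fun=> b); split=> //; rewrite big_ord1.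
Qed.

Lemma mul_ideal_sub I J N : submodule N ->
  (forall a b, I a -> J b -> N (a * b)) -> mul_ideal I J `<=` N.
Proof.
by move=> sN NM _ [n [a [b [Ia Jb ->]]]]; apply: submodule_sum => // i; apply: NM.
Qed.

Lemma mul_idealD I J x y :
  mul_ideal I J x -> mul_ideal I J y -> mul_ideal I J (x + y).
Proof.
move=> [n [a [b [Ia Jb ->]]]] [m [a' [b' [Ia' Jb' ->]]]].
pose glue (f : 'I_n -> K) (f' : 'I_m -> K) (i : 'I_(n + m)) :=
  match fintype.split i with inl j => f j | inr j => f' j end.
have gl f f' j : glue f f' (lshift m j) = f j.
  by rewrite /glue (unsplitK (inl j)).
have gr f f' j : glue f f' (rshift n j) = f' j.
  by rewrite /glue (unsplitK (inr j)).
exists (n + m)%N, (glue a a'), (glue b b'); split.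
- by move=> i; rewrite /glue; case: fintype.split.
- by move=> i; rewrite /glue; case: fintype.split.
- by rewrite big_split_ord /=; congr (_ + _); apply: eq_bigr => i _;
    rewrite ?gl ?gr.
Qed.

Lemma mul_submodule I J : submodule I -> submodule (mul_ideal I J).
Proof.
move=> [_ _ IM]; split; last 1 first.
- move=> d _ [n [a [b [Ia Jb ->]]]]; exists n, (fun i => d%:F * a i), b.
  split=> // [i|]; first exact: IM.
  by rewrite mulr_sumr; apply: eq_bigr => i _; rewrite mulrA.
- by exists 0%N, (fun=> 0), (fun=> 0); split; [case|case|rewrite big_ord0].
- exact: mul_idealD.
Qed.

Lemma mul_idealS I I' J J' : I `<=` I' -> J `<=` J' ->
  mul_ideal I J `<=` mul_ideal I' J'.
Proof.
move=> II' JJ' _ [n [a [b [Ia Jb ->]]]]; exists n, a, b.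
by split=> // i; [apply: II'|apply: JJ'].
Qed.

Lemma mul_idealC I J : mul_ideal I J = mul_ideal J I.
Proof.
have sub A B : mul_ideal A B `<=` mul_ideal B A.
  move=> _ [n [a [b [Aa Bb ->]]]]; exists n, b, a; split=> //.
  by apply: eq_bigr => i _; rewrite mulrC.
by rewrite eqEsubset; split.
Qed.

Lemma mul_idealA I J L : submodule I -> submodule J -> submodule L ->
  mul_ideal I (mul_ideal J L) = mul_ideal (mul_ideal I J) L.
Proof.
have sub A B C : submodule A -> submodule B ->
    mul_ideal A (mul_ideal B C) `<=` mul_ideal (mul_ideal A B) C.
  move=> sA sB; have sABC := mul_submodule C (mul_submodule B sA).
  apply: mul_ideal_sub => // a _ Aa [n [b [c [Bb Cc ->]]]].
  rewrite mulr_sumr; apply: submodule_sum => // i.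
  by rewrite mulrA; apply: mul_ideal_gen => //; apply: mul_ideal_gen.
move=> sI sJ sL; rewrite eqEsubset; split; first exact: sub.
rewrite [X in X `<=` _]mul_idealC (mul_idealC I J) (mul_idealC J L).
by rewrite [X in _ `<=` X]mul_idealC; apply: sub.
Qed.

Lemma mul_ideal1 I : fractional_ideal I -> mul_ideal (integers D) I = I.
Proof.
move=> [I0 ID IM _ _]; rewrite eqEsubset; split.
  by apply: mul_ideal_sub => // _ b [d _ <-] Ib; apply: IM.
move=> x Ix; rewrite -[x]mul1r; apply: mul_ideal_gen => //; exact: integers1.
Qed.

Lemma fractional_mul I J : fractional_ideal I -> fractional_ideal J ->
  fractional_ideal (mul_ideal I J).
Proof.
move=> fI fJ; have [] := mul_submodule J (fractional_submodule fI).
have [_ _ _ [x Ix x0] [d d0 dI]] := fI; have [_ _ _ [y Jy y0] [c c0 cJ]] := fJ.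
split=> //.
  by exists (x * y); [apply: mul_ideal_gen|rewrite mulf_neq0].
exists (d * c); first by rewrite mulf_neq0.
move=> _ [n [a [b [Ia Jb ->]]]]; rewrite mulr_sumr.
apply: submodule_sum => [|i]; first exact: fractional_submodule fractional_integers.
by rewrite rmorphM mulrACA; apply: integersM; [apply: dI|apply: cJ].
Qed.

Lemma fractional_add I J : fractional_ideal I -> fractional_ideal J ->
  fractional_ideal (add_ideal I J).
Proof.
move=> [I0 ID IM [x Ix x0] [d d0 dI]] [J0 JD JM [y Jy y0] [d' d'0 dJ]].
split.
- by exists 0 => //; exists 0; rewrite ?addr0.
- move=> _ _ [a Ia [b Jb <-]] [a' Ia' [b' Jb' <-]].
  by exists (a + a'); [exact: ID|exists (b + b'); [exact: JD|rewrite addrACA]].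
- move=> c _ [a Ia [b Jb <-]].
  by exists (c%:F * a); [exact: IM|exists (c%:F * b); [exact: JM|rewrite mulrDr]].
- by exists x => //; exists x => //; exists 0; rewrite ?addr0.
have [_ integersD _ _ _] := fractional_integers.
exists (d * d'); first by rewrite mulf_neq0.
move=> _ [a Ia [b Jb <-]]; rewrite rmorphM mulrDr; apply: integersD.
  by rewrite mulrAC mulrC; apply: integersM; [exact: integersP|exact: dI].
by rewrite -mulrA; apply: integersM; [exact: integersP|exact: dJ].
Qed.

Lemma add_ideal_subl I J : fractional_ideal J -> I `<=` add_ideal I J.
Proof. by move=> [J0 _ _ _ _] x Ix; exists x => //; exists 0; rewrite ?addr0. Qed.

Lemma add_ideal_subr I J : fractional_ideal I -> J `<=` add_ideal I J.
Proof. by move=> [I0 _ _ _ _] x Jx; exists 0 => //; exists x; rewrite ?add0r. Qed.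

Lemma add_ideal_sub I J N : submodule N -> I `<=` N -> J `<=` N ->
  add_ideal I J `<=` N.
Proof. by move=> [_ ND _] IN JN _ [x /IN Nx [y /JN Ny <-]]; apply: ND. Qed.

Lemma mul_ideal_addr I J L : fractional_ideal I -> fractional_ideal J ->
  fractional_ideal L ->
  mul_ideal L (add_ideal I J) = add_ideal (mul_ideal L I) (mul_ideal L J).
Proof.
move=> fI fJ fL; rewrite eqEsubset; split.
  have fLIJ := fractional_add (fractional_mul fL fI) (fractional_mul fL fJ).
  apply: mul_ideal_sub; first exact: fractional_submodule.
  move=> l _ Ll [x Ix [y Jy <-]].
  exists (l * x); first exact: mul_ideal_gen.
  by exists (l * y); [exact: mul_ideal_gen|rewrite mulrDr].
apply: add_ideal_sub.
- by apply: mul_submodule; apply: fractional_submodule.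
- by apply: mul_idealS => //; apply: add_ideal_subl.
- by apply: mul_idealS => //; apply: add_ideal_subr.
Qed.

Lemma fg_mul I J : fg_fractional_ideal I -> fg_fractional_ideal J ->
  fg_fractional_ideal (mul_ideal I J).
Proof.
move=> [fI [n [g eI]]] [fJ [m [h eJ]]].
apply: (@fg_finType ('I_n * 'I_m)%type (fun p => g p.1 * h p.2)).
- exact: fractional_mul.
- by move=> p; apply: mul_ideal_gen; rewrite ?eI ?eJ; apply: span_gen.
move=> N sN Ngh; have [_ _ NM] := sN; apply: mul_ideal_sub => // a b.
rewrite eI eJ => -[c _ <-] [d _ <-]; rewrite mulr_suml.
apply: submodule_sum => // i; rewrite mulr_sumr; apply: submodule_sum => // j.
by rewrite mulrACA -rmorphM; apply: NM; apply: (Ngh (i, j)).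
Qed.

Lemma fg_add I J : fg_fractional_ideal I -> fg_fractional_ideal J ->
  fg_fractional_ideal (add_ideal I J).
Proof.
move=> [fI [n [g eI]]] [fJ [m [h eJ]]].
apply: (@fg_finType ('I_n + 'I_m)%type
         (fun s => match s with inl i => g i | inr j => h j end)).
- exact: fractional_add.
- case=> [i|j]; [apply: add_ideal_subl|apply: add_ideal_subr] => //;
    by rewrite ?eI ?eJ; apply: span_gen.
move=> N sN Ngh; apply: add_ideal_sub => //; rewrite ?eI ?eJ; apply: span_sub => //.
  by move=> i; apply: (Ngh (inl i)).
by move=> j; apply: (Ngh (inr j)).
Qed.

(** * The monoid of star-ideals of finite type *)

Section Star.
Context {star : set K -> set K}.
Hypothesis star_op : star_operation star.

Lemma star_sub I J : fractional_ideal I -> fractional_ideal J ->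
  I `<=` star J -> star I `<=` star J.
Proof.
move=> fI fJ IJ; rewrite -(star_idem star_op fJ).
by apply: (star_mono star_op) => //; apply: (star_fractional star_op).
Qed.

Lemma star_integers : star (integers D) = integers D.
Proof.
by rewrite integers_principal; apply: (star_principal star_op); apply: oner_neq0.
Qed.

(** For [b] in [J] nonzero, [b (star I) = star (b I)] is contained in
    [star (I J)]; these products generate [(star I) J]. *)
Lemma star_mull I J : fractional_ideal I -> fractional_ideal J ->
  star (mul_ideal (star I) J) = star (mul_ideal I J).
Proof.
move=> fI fJ; have fsI := star_fractional star_op fI.
have fIJ := fractional_mul fI fJ; have fsIJ := star_fractional star_op fIJ.
rewrite eqEsubset; split; last first.
  apply: (star_mono star_op) => //; first exact: fractional_mul.
  by apply: mul_idealS => //; apply: (star_ext star_op).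
apply: star_sub => //; first exact: fractional_mul.
apply: mul_ideal_sub; first exact: fractional_submodule.
move=> a b sIa Jb; rewrite mulrC; have [->|b0] := eqVneq b 0.
  by rewrite mul0r; case: fsIJ.
have bIJ : scale_ideal b I `<=` mul_ideal I J.
  by move=> _ [x Ix <-]; rewrite mulrC; apply: mul_ideal_gen.
have fbI : fractional_ideal (scale_ideal b I).
  have [I0 ID IM [y Iy y0] _] := fI; apply: (fractional_sub fIJ bIJ).
    split; first by exists 0; rewrite ?mulr0.
      by move=> _ _ [u Iu <-] [v Iv <-]; exists (u + v); [exact: ID|rewrite mulrDr].
    by move=> d _ [u Iu <-]; exists (d%:F * u); [exact: IM|rewrite mulrCA].
  by exists (b * y); [exists y|rewrite mulf_neq0].
apply: (star_mono star_op fbI fIJ bIJ); rewrite (star_scale star_op b0 fI).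
by exists a.
Qed.

Lemma star_mulr I J : fractional_ideal I -> fractional_ideal J ->
  star (mul_ideal I (star J)) = star (mul_ideal I J).
Proof. by move=> fI fJ; rewrite mul_idealC star_mull // mul_idealC. Qed.

Lemma star_add I J : fractional_ideal I -> fractional_ideal J ->
  star (add_ideal (star I) (star J)) = star (add_ideal I J).
Proof.
move=> fI fJ; have fsI := star_fractional star_op fI.
have fsJ := star_fractional star_op fJ; have fIJ := fractional_add fI fJ.
have IIJ := add_ideal_subl (I := I) fJ; have JIJ := add_ideal_subr (J := J) fI.
rewrite eqEsubset; split.
  apply: star_sub => //; first exact: fractional_add.
  apply: add_ideal_sub; last 2 first.
  - exact: (star_mono star_op).
  - exact: (star_mono star_op).
  - by apply: fractional_submodule; apply: (star_fractional star_op).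
apply: (star_mono star_op) => //; first exact: fractional_add.
apply: add_ideal_sub.
- by apply: fractional_submodule; apply: fractional_add.
- by apply: subset_trans (add_ideal_subl fsJ); apply: (star_ext star_op).
- by apply: subset_trans (add_ideal_subr fsI); apply: (star_ext star_op).
Qed.

Lemma phi_fractional I : pset (phi star) I -> fractional_ideal I.
Proof. by case=> -[]. Qed.

Lemma phi_star I : pset (phi star) I -> star I = I.
Proof. by case=> -[_ [J [fJ _] ->]] _; apply: (star_idem star_op). Qed.

Lemma phiP J : fg_fractional_ideal J -> J `<=` integers D ->
  pset (phi star) (star J).
Proof.
move=> fgJ JD; have [fJ _] := fgJ; split.
  by split; [apply: (star_fractional star_op)|exists J].
by rewrite -star_integers; apply: (star_mono star_op) => //; apply: fractional_integers.
Qed.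

Lemma phi_gen I : pset (phi star) I ->
  exists J, [/\ fg_fractional_ideal J, J `<=` integers D & I = star J].
Proof.
move=> [[_ [J fgJ eI]] ID]; exists J; split=> //.
apply: subset_trans ID; rewrite eI; apply: (star_ext star_op); exact: fgJ.1.
Qed.

Lemma phi_mul I J : pset (phi star) I -> pset (phi star) J ->
  pset (phi star) (star_mul star I J).
Proof.
move=> /phi_gen[A [fgA AD ->]] /phi_gen[B [fgB BD ->]].
have [[fA _] [fB _]] := (fgA, fgB); rewrite /star_mul star_mull //; last first.
  exact: (star_fractional star_op).
rewrite star_mulr //; apply: phiP; first exact: fg_mul.
apply: mul_ideal_sub; first exact: fractional_submodule fractional_integers.
by move=> a b /AD Da /BD Db; apply: integersM.
Qed.

Lemma phi_add I J : pset (phi star) I -> pset (phi star) J ->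
  pset (phi star) (star (add_ideal I J)).
Proof.
move=> /phi_gen[A [fgA AD ->]] /phi_gen[B [fgB BD ->]].
have [[fA _] [fB _]] := (fgA, fgB); rewrite star_add //.
apply: phiP; first exact: fg_add.
by apply: add_ideal_sub => //; apply: fractional_submodule fractional_integers.
Qed.

Lemma phi_principal (d : D) : d != 0 -> pset (phi star) (principal d%:F).
Proof.
move=> d0; rewrite -(star_principal star_op); last by rewrite tofrac_eq0.
apply: phiP; first exact: fg_principal.
apply: principal_sub (integersP d).
exact: fractional_submodule fractional_integers.
Qed.

Lemma phi_integers : pset (phi star) (integers D).
Proof.
by rewrite integers_principal -tofrac1; apply: phi_principal; apply: oner_neq0.
Qed.

Lemma phi_pomonoid : is_pomonoid (phi star).
Proof.
have fr := phi_fractional.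
have sm I (pI : pset (phi star) I) := fractional_submodule (fr I pI).
split=> /=.
- exact: phi_integers.
- exact: phi_mul.
- move=> I J L pI pJ pL; rewrite /star_mul star_mulr ?star_mull //; auto.
  + by rewrite mul_idealA; auto.
  + by apply: fractional_mul; auto.
  + by apply: fractional_mul; auto.
- by move=> I J _ _; rewrite /star_mul mul_idealC.
- by move=> I pI; rewrite /star_mul mul_ideal1 ?phi_star //; apply: fr.
- by move=> I _ x.
- by move=> I J _ _ JI IJ; rewrite eqEsubset; split.
- by move=> I J L _ _ _ JI LJ; apply: subset_trans LJ JI.
- move=> I J L pI pJ pL JI; apply: (star_mono star_op).
  + by apply: fractional_mul; auto.
  + by apply: fractional_mul; auto.
  + exact: mul_idealS.
Qed.

Lemma phi_meet_monoid :
  is_meet_monoid (phi star) (fun I J => star (add_ideal I J)).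
Proof.
split=> /=; first exact: phi_pomonoid.
- by move=> I [].
- move=> I J pI pJ; have [fI fJ] := (phi_fractional pI, phi_fractional pJ).
  have fIJ := fractional_add fI fJ.
  split; first (split; first exact: phi_add).
    move=> _ [] -> /=; apply: subset_trans (star_ext star_op fIJ).
      exact: add_ideal_subl.
    exact: add_ideal_subr.
  move=> L [pL lb]; have fL := phi_fractional pL.
  rewrite /= -(phi_star pL); apply: (star_mono star_op) => //.
  apply: add_ideal_sub; first exact: fractional_submodule.
    by apply: lb; left.
  by apply: lb; right.
- move=> I J L pI pJ pL.
  have [[fI fJ] fL] := (phi_fractional pI, phi_fractional pJ, phi_fractional pL).
  rewrite /star_mul star_mulr //; last exact: fractional_add.
  by rewrite mul_ideal_addr // star_add //; apply: fractional_mul.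
Qed.

Lemma phi_homogeneousP I :
  homogeneous (phi star) I <-> homogeneous_ideal star I.
Proof. exact: (homogeneousP phi_meet_monoid). Qed.

(** Larger elements are smaller ideals: [I] lies below the principal ideal of
    any nonzero [d] in [I], and that ideal is a product of homogeneous ones. *)
Lemma star_SH_dominated : star_SH star -> forall I, pset (phi star) I ->
  I <> integers D -> exists2 J, pset (Hh (phi star)) J & J `<=` I.
Proof.
move=> SH I pI neI; have fI := phi_fractional pI.
have [_ _ _ [x Ix x0] _] := fI.
have [d _ dx] : integers D x by case: pI => _; apply.
have dI : principal d%:F `<=` I.
  by apply: principal_sub; [exact: fractional_submodule|rewrite dx].
have d0 : d != 0 by rewrite -tofrac_eq0 dx.
exists (principal d%:F) => //.
have [|n [h [n0 hh ->]]] := SH d d0.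
  move=> dD; apply: neI; rewrite eqEsubset; split; first by case: pI.
  by rewrite -dD.
by apply/HhP; exists n, h; split=> // i; apply/phi_homogeneousP.
Qed.

End Star.
End Ideals.

Theorem proposition4p19 (D : idomainType)
    (D_neq_K : integers D <> [set: {fraction D}]%classic)
    (star : set {fraction D} -> set {fraction D})
    (star_op : star_operation star)
    (star_fin : finite_character star) :
  [/\ pre_Riesz (phi star) /\ meet_smooth (phi star),
      star_SH star <-> v_factorial (phi star)
    & (homogeneous (phi star) !=set0)%classic -> v_factorial (Hh (phi star))].
Proof.
have MM := phi_meet_monoid star_op; split.
- by split; [exact: meet_monoid_pre_Riesz MM|exact: meet_monoid_smooth MM].
- split=> [SH|[[_ _ _ factor] _] d d0 dD].
    exact: meet_monoid_v_factorial MM (star_SH_dominated star_op SH).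
  have pd := phi_principal star_op d0.
  have [|n [h [n0 hh ed]]] := factor _ pd; first exact/(lt_eP MM).
  by exists n, h; split=> // i; apply/(phi_homogeneousP star_op).
- by move=> _; exact: Hh_v_factorial MM.
Qed.
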